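(* Let $(X,\Sigma,\lambda)$ be a positive measure space and let $f,g\in L_1(X)$. Then $f\perp_B g$ if and only if $$\left|\int_X\overline{\operatorname{sgn}(f(x))}\,g(x)\,d\lambda(x)\right|\le\int_{\{x\in X:\,f(x)=0\}}|g(x)|\,d\lambda(x).$$
   Context: $\mathbb{K}$ is $\mathbb{R}$ or $\mathbb{C}$; $L_1(X)$ is the space of integrable $\mathbb{K}$-valued functions (modulo a.e. equality) with norm $\|f\|_1=\int_X|f|\,d\lambda$. $\operatorname{sgn}(z)=z/|z|$ for $z\ne0$ and $\operatorname{sgn}(0)=0$. In a normed space over $\mathbb{K}$, $x\perp_B y$ (Birkhoff-James orthogonality) means $\|x+\alpha y\|\ge\|x\|$ for all $\alpha\in\mathbb{K}$. *)

(* Defs.v *)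
From HB Require Import structures.
From mathcomp Require Import all_boot all_order all_algebra generic_quotient.
From mathcomp Require Import all_classical all_reals all_analysis measurable_realfun.
From mathcomp Require Import complex.

Set Implicit Arguments.
Unset Strict Implicit.
Unset Printing Implicit Defensive.
Import Order.TTheory GRing.Theory Num.Theory.
Import numFieldNormedType.Exports.

Local Open Scope classical_set_scope.
Local Open Scope ring_scope.
Local Open Scope quotient_scope.

Section BirkhoffJames.
Context (K : numFieldType) (V : normedModType K).

Definition BJ_orthogonal (x y : V) : Prop :=
  forall a : K, `|x| <= `|x + a *: y|.

End BirkhoffJames.

Definition sgn (K : numFieldType) (z : K) : K :=
  if z == 0 then 0 else z / `|z|.

(* The two admissible scalar fields. In both of them the norm [`|z|] is an
   element of the field itself: on [R[i]] it is the modulus seen as a complex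
   number with zero imaginary part, and [x <= y] means that [y - x] is a
   nonnegative real. *)
Variant scalar_kind := RealScalars | ComplexScalars.

Section Scalars.
Context (R : realType).

Definition scalar (k : scalar_kind) : numFieldType :=
  match k with
  | RealScalars => R
  | ComplexScalars => R[i]
  end.

Definition scRe (k : scalar_kind) : scalar k -> R :=
  match k return scalar k -> R with
  | RealScalars => fun x => x
  | ComplexScalars => fun z => complex.Re z
  end.

Definition scIm (k : scalar_kind) : scalar k -> R :=
  match k return scalar k -> R with
  | RealScalars => fun _ => 0
  | ComplexScalars => fun z => complex.Im z
  end.

Definition scConj (k : scalar_kind) : scalar k -> scalar k :=
  match k return scalar k -> scalar k with
  | RealScalars => fun x => x
  | ComplexScalars => fun z => conjc z
  end.

Definition scOfReal (k : scalar_kind) : R -> scalar k :=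
  match k return R -> scalar k with
  | RealScalars => fun x => x
  | ComplexScalars => fun x => Complex x 0
  end.

End Scalars.

Section Integral.
Context (R : realType) (k : scalar_kind) d (X : measurableType d).
Variable mu : {measure set X -> \bar R}.

(* Borel measurability of a complex-valued function is measurability of its
   real and imaginary parts. *)
Definition scMeasurable (f : X -> scalar R k) : Prop :=
  measurable_fun [set: X] (fun x => scRe (f x)) /\
  measurable_fun [set: X] (fun x => scIm (f x)).

Definition scIntegrable (f : X -> scalar R k) : Prop :=
  scMeasurable f /\ (\int[mu]_x (scRe `|f x|)%:E < +oo)%E.

End Integral.

Definition scIntegral (R : realType) (k : scalar_kind) d (X : measurableType d)
    (mu : {measure set X -> \bar R}) (D : set X) :
    (X -> scalar R k) -> scalar R k :=
  match k return (X -> scalar R k) -> scalar R k with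
  | RealScalars => fun f => \int[mu]_(x in D) f x
  | ComplexScalars => fun f =>
      Complex (\int[mu]_(x in D) complex.Re (f x))
              (\int[mu]_(x in D) complex.Im (f x))
  end.

Section ScalarTheory.
Context (R : realType) (k : scalar_kind).
Implicit Types (x y z : scalar R k) (a b : R).

Lemma scReD x y : scRe (x + y) = scRe x + scRe y.
Proof. by case: k x y => // -[? ?] [? ?]. Qed.

Lemma scImD x y : scIm (x + y) = scIm x + scIm y.
Proof. by case: k x y => [x y|[? ?] [? ?]] //=; rewrite addr0. Qed.

Lemma scReM x y : scRe (x * y) = scRe x * scRe y - scIm x * scIm y.
Proof. by case: k x y => [x y|[? ?] [? ?]] //=; rewrite mulr0 subr0. Qed.

Lemma scImM x y : scIm (x * y) = scRe x * scIm y + scIm x * scRe y.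
Proof. by case: k x y => [x y|[? ?] [? ?]] //=; rewrite mulr0 mul0r addr0. Qed.

Lemma scRe_norm z : scRe `|z| = Num.sqrt (scRe z ^+ 2 + scIm z ^+ 2).
Proof.
by case: k z => [z|[? ?]] //=; rewrite expr0n /= addr0 sqrtr_sqr.
Qed.

Lemma scOfReal_norm z : scOfReal k (scRe `|z|) = `|z|.
Proof. by case: k z => [z|[? ?]]. Qed.

Lemma scRe_OfReal a : scRe (scOfReal k a) = a.
Proof. by case: k. Qed.

Lemma scOfReal_inj : injective (@scOfReal R k).
Proof. by apply: (can_inj (g := @scRe R k)) => a; exact: scRe_OfReal. Qed.

Lemma scOfRealD a b : scOfReal k (a + b) = scOfReal k a + scOfReal k b.
Proof. by case: k => //=; apply/eqP; rewrite eq_complex /= addr0 !eqxx. Qed.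

Lemma scOfRealM a b : scOfReal k (a * b) = scOfReal k a * scOfReal k b.
Proof.
by case: k => //=; apply/eqP; rewrite eq_complex /= !mulr0 mul0r subr0 addr0
  !eqxx.
Qed.

Lemma scOfReal0 : scOfReal k (0 : R) = 0.
Proof. by case: k. Qed.

Lemma scOfReal_le a b : (scOfReal k a <= scOfReal k b) = (a <= b).
Proof. by case: k => //=; rewrite lecR. Qed.

Lemma scRe_norm_ge0 z : 0 <= scRe `|z|.
Proof. by rewrite scRe_norm sqrtr_ge0. Qed.

Lemma scRe_normD x y : scRe `|x + y| <= scRe `|x| + scRe `|y|.
Proof.
by rewrite -scOfReal_le scOfRealD !scOfReal_norm ler_normD.
Qed.

Lemma scRe_normM x y : scRe `|x * y| = scRe `|x| * scRe `|y|.
Proof. by apply: scOfReal_inj; rewrite scOfRealM !scOfReal_norm normrM. Qed.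

Lemma scRe_norm_eq0 z : scRe `|z| = 0 -> z = 0.
Proof.
by move=> z0; apply/eqP; rewrite -normr_eq0 -scOfReal_norm z0 scOfReal0.
Qed.

End ScalarTheory.

Section IntegrableTheory.
Context (R : realType) (k : scalar_kind) d (X : measurableType d).
Variable mu : {measure set X -> \bar R}.
Implicit Types f g : X -> scalar R k.

Lemma measurable_scRe_norm f :
  scMeasurable f -> measurable_fun [set: X] (fun x => scRe `|f x|).
Proof.
move=> [mr mi]; under eq_fun do rewrite scRe_norm.
apply: (@measurableT_comp _ _ _ _ _ _ (@Num.sqrt R)).
  by apply: continuous_measurable_fun; exact: sqrt_continuous.
by apply: measurable_funD; apply: measurable_funX.
Qed.

Lemma scIntegral_norm D f :
  scIntegral mu D (fun x => `|f x|) = scOfReal k (\int[mu]_(x in D) scRe `|f x|).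
Proof.
rewrite /scIntegral; case: k f => // f /=.
by congr Complex; rewrite /Rintegral integral0.
Qed.

Lemma scIntegrable_norm f :
  scIntegrable mu f -> mu.-integrable [set: X] (fun x => (scRe `|f x|)%:E).
Proof.
move=> [mf fi]; apply/integrableP; split.
  by apply/measurable_EFinP; exact: measurable_scRe_norm.
by under eq_integral do rewrite gee0_abs ?lee_fin ?scRe_norm_ge0//.
Qed.

Lemma scIntegrable0 : scIntegrable mu (fun=> 0 : scalar R k).
Proof.
split; first by split; exact: measurable_cst.
by rewrite normr0 -(scOfReal0 R k) scRe_OfReal integral0.
Qed.

Lemma scIntegrableD f g : scIntegrable mu f -> scIntegrable mu g ->
  scIntegrable mu (fun x => f x + g x).
Proof.
move=> If Ig; have [[fr fi] _] := If; have [[gr gi] _] := Ig.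
have mD : scMeasurable (fun x => f x + g x).
  split; [under eq_fun do rewrite scReD|under eq_fun do rewrite scImD];
  exact: measurable_funD.
split=> //.
have /integrableP[_] := integrableD measurableT (scIntegrable_norm If)
                                    (scIntegrable_norm Ig).
apply: le_lt_trans; apply: ge0_le_integral => //.
- by move=> x _; rewrite lee_fin scRe_norm_ge0.
- by apply/measurable_EFinP; exact: measurable_scRe_norm.
- apply/measurableT_comp => //; apply: emeasurable_funD;
    by apply/measurable_EFinP; apply: measurable_scRe_norm.
- move=> x _ /=; rewrite lee_fin (le_trans (scRe_normD _ _))//.
  exact: ler_norm.
Qed.

Lemma scIntegrableZ (a : scalar R k) f : scIntegrable mu f ->
  scIntegrable mu (fun x => a * f x).
Proof.
move=> If; have [[fr fi] _] := If.
have mZ : scMeasurable (fun x => a * f x).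
  split.
    under eq_fun do rewrite scReM.
    by apply: measurable_funB; apply: measurable_funM.
  under eq_fun do rewrite scImM.
  by apply: measurable_funD; apply: measurable_funM.
split=> //.
under eq_integral do rewrite scRe_normM EFinM.
rewrite integralZl//; last exact: scIntegrable_norm.
have [_ Ify] := If.
by rewrite lte_mul_pinfty// lee_fin scRe_norm_ge0.
Qed.

End IntegrableTheory.

Record integrable_fun (R : realType) (k : scalar_kind) d (X : measurableType d)
    (mu : {measure set X -> \bar R}) := IntegrableFun {
  integrable_fun_val :> X -> scalar R k;
  integrable_funP : scIntegrable mu integrable_fun_val
}.

HB.instance Definition _ (R : realType) (k : scalar_kind) d
    (X : measurableType d) (mu : {measure set X -> \bar R}) :=
  gen_eqMixin (integrable_fun k mu).
HB.instance Definition _ (R : realType) (k : scalar_kind) d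
    (X : measurableType d) (mu : {measure set X -> \bar R}) :=
  gen_choiceMixin (integrable_fun k mu).

Section L1.
Context (R : realType) (k : scalar_kind) d (X : measurableType d).
Variable mu : {measure set X -> \bar R}.
Local Notation K := (scalar R k).

Definition ae_equal (f g : integrable_fun k mu) : bool :=
  `[< (f : X -> K) = g %[ae mu] >].

Let ae_equal_refl : reflexive ae_equal.
Proof. by move=> f; apply/asboolP; exact: ae_eq_refl. Qed.

Let ae_equal_sym : symmetric ae_equal.
Proof.
by move=> f g; apply/idP/idP => /asboolP h; apply/asboolP/ae_eq_sym.
Qed.

Let ae_equal_trans : transitive ae_equal.
Proof.
by move=> f g h /asboolP gf /asboolP fh; apply/asboolP/(ae_eq_trans gf fh).
Qed.

Canonical ae_equal_equiv :=
  EquivRel ae_equal ae_equal_refl ae_equal_sym ae_equal_trans.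

Definition L1 : Type := {eq_quot ae_equal}.
HB.instance Definition _ := Choice.on L1.
HB.instance Definition _ := EqQuotient.on L1.

(* An element of [L1] is applied to a point through a chosen representative. *)
Definition L1_fun (f : L1) : X -> K := repr f.
Coercion L1_fun : L1 >-> Funclass.

Definition L1_class (f : X -> K) (fi : scIntegrable mu f) : L1 :=
  \pi_L1 (IntegrableFun fi).

Lemma L1_integrable (f : L1) : scIntegrable mu f.
Proof. exact: integrable_funP. Qed.

Lemma L1P (f g : L1) : f = g <-> (f : X -> K) = g %[ae mu].
Proof.
split=> [->|fg]; first exact: ae_eq_refl.
by rewrite -[f]reprK -[g]reprK; apply/eqP; rewrite eqmodE; apply/asboolP.
Qed.

Lemma L1_classE (f : X -> K) (fi : scIntegrable mu f) :
  (L1_class fi : X -> K) = f %[ae mu].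
Proof.
have /eqP : \pi_L1 (repr (L1_class fi)) = \pi_L1 (IntegrableFun fi).
  by rewrite reprK.
by rewrite eqmodE => /asboolP.
Qed.

Definition L1_zero : L1 := L1_class (scIntegrable0 k mu).
Definition L1_add (f g : L1) : L1 :=
  L1_class (scIntegrableD (L1_integrable f) (L1_integrable g)).
Definition L1_scale (a : K) (f : L1) : L1 :=
  L1_class (scIntegrableZ a (L1_integrable f)).
Definition L1_opp (f : L1) : L1 := L1_scale (-1) f.

Lemma L1_zeroE : {ae mu, forall x, L1_zero x = 0}.
Proof. by apply: filterS (L1_classE (scIntegrable0 k mu)) => x /(_ I). Qed.

Lemma L1_addE f g : {ae mu, forall x, L1_add f g x = f x + g x}.
Proof.
by apply: filterS (L1_classE (scIntegrableD (L1_integrable f)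
  (L1_integrable g))) => x /(_ I).
Qed.

Lemma L1_scaleE a f : {ae mu, forall x, L1_scale a f x = a * f x}.
Proof.
by apply: filterS (L1_classE (scIntegrableZ a (L1_integrable f))) => x /(_ I).
Qed.

Lemma L1_eq f g : {ae mu, forall x, (f : L1) x = (g : L1) x} -> f = g.
Proof. by move=> fg; apply/L1P; apply: filterS fg. Qed.

Let L1_addA : associative L1_add.
Proof.
move=> f g h; apply: L1_eq.
near=> x.
rewrite (near (L1_addE f (L1_add g h)) x)// (near (L1_addE g h) x)//.
rewrite (near (L1_addE (L1_add f g) h) x)// (near (L1_addE f g) x)//.
exact: addrA.
Unshelve. all: by end_near. Qed.

Let L1_addC : commutative L1_add.
Proof.
move=> f g; apply: L1_eq.
by apply: filterS2 (L1_addE f g) (L1_addE g f) => x -> ->; exact: addrC.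
Qed.

Let L1_add0 : left_id L1_zero L1_add.
Proof.
move=> f; apply: L1_eq.
by apply: filterS2 (L1_addE L1_zero f) L1_zeroE => x -> ->; exact: add0r.
Qed.

Let L1_addN : left_inverse L1_zero L1_opp L1_add.
Proof.
move=> f; apply: L1_eq.
apply: filterS3 (L1_addE (L1_opp f) f) (L1_scaleE (-1) f) L1_zeroE.
by move=> x -> -> ->; rewrite mulN1r addNr.
Qed.

HB.instance Definition _ :=
  GRing.isZmodule.Build L1 L1_addA L1_addC L1_add0 L1_addN.

Let L1_scaleA a b (f : L1) : L1_scale a (L1_scale b f) = L1_scale (a * b) f.
Proof.
apply: L1_eq; apply: filterS3 (L1_scaleE a (L1_scale b f)) (L1_scaleE b f)
  (L1_scaleE (a * b) f) => x -> -> ->.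
exact: mulrA.
Qed.

Let L1_scale1 : left_id 1 L1_scale.
Proof.
move=> f; apply: L1_eq.
by apply: filterS (L1_scaleE 1 f) => x ->; exact: mul1r.
Qed.

Let L1_scaleDr : right_distributive L1_scale +%R.
Proof.
move=> a f g; apply: L1_eq.
near=> x.
rewrite (near (L1_scaleE a (f + g)) x)//.
rewrite (near (L1_addE f g) x)//.
rewrite (near (L1_addE (L1_scale a f) (L1_scale a g)) x)//.
rewrite (near (L1_scaleE a f) x)// (near (L1_scaleE a g) x)//.
exact: mulrDr.
Unshelve. all: by end_near. Qed.

Let L1_scaleDl (f : L1) : {morph L1_scale^~ f : a b / a + b}.
Proof.
move=> a b; apply: L1_eq.
near=> x.
rewrite (near (L1_scaleE (a + b) f) x)//.
rewrite (near (L1_addE (L1_scale a f) (L1_scale b f)) x)//.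
rewrite (near (L1_scaleE a f) x)// (near (L1_scaleE b f) x)//.
exact: mulrDl.
Unshelve. all: by end_near. Qed.

HB.instance Definition _ := GRing.Zmodule_isLmodule.Build K L1
  L1_scaleA L1_scale1 L1_scaleDr L1_scaleDl.

Definition L1_norm (f : L1) : K := scIntegral mu [set: X] (fun x => `|f x|).

Lemma L1_normE (f : L1) (g : X -> K) : scIntegrable mu g ->
  {ae mu, forall x, f x = g x} ->
  L1_norm f = scOfReal k (\int[mu]_x scRe `|g x|).
Proof.
move=> gi fg; rewrite /L1_norm scIntegral_norm; congr (scOfReal k (fine _)).
have [mf _] := L1_integrable f; have [mg _] := gi.
apply: ge0_ae_eq_integral => //.
- by apply/measurable_EFinP; exact: measurable_scRe_norm.
- by apply/measurable_EFinP; exact: measurable_scRe_norm.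
- by move=> x _; rewrite lee_fin scRe_norm_ge0.
- by move=> x _; rewrite lee_fin scRe_norm_ge0.
- by apply: filterS fg => x /= ->.
Qed.

Let L1_normD (f g : L1) : L1_norm (f + g) <= L1_norm f + L1_norm g.
Proof.
have Ig := scIntegrable_norm (L1_integrable g).
have If := scIntegrable_norm (L1_integrable f).
have Ifg := scIntegrableD (L1_integrable f) (L1_integrable g).
rewrite (L1_normE Ifg (L1_addE f g)) /L1_norm !scIntegral_norm -scOfRealD.
rewrite scOfReal_le -RintegralD//; apply: le_Rintegral => //.
- exact: scIntegrable_norm.
- exact: (integrableD measurableT If Ig).
- by move=> x _; exact: scRe_normD.
Qed.

Let L1_normZ (a : K) (f : L1) : L1_norm (a *: f) = `|a| * L1_norm f.
Proof.
have Iaf := scIntegrableZ a (L1_integrable f).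
rewrite (L1_normE Iaf (L1_scaleE a f)) /L1_norm scIntegral_norm.
under eq_Rintegral do rewrite scRe_normM.
rewrite RintegralZl//; last exact/scIntegrable_norm/L1_integrable.
by rewrite scOfRealM scOfReal_norm.
Qed.

Let L1_norm0_eq0 (f : L1) : L1_norm f = 0 -> f = 0.
Proof.
have [mf fy] := L1_integrable f.
have i0 : (0 <= \int[mu]_x (scRe `|f x|)%:E)%E.
  by apply: integral_ge0 => x _; rewrite lee_fin scRe_norm_ge0.
rewrite /L1_norm scIntegral_norm -(scOfReal0 R k) => /scOfReal_inj.
move=> /(congr1 (@EFin R)); rewrite /Rintegral fineK ?ge0_fin_numE// => int0.
have : (\int[mu]_x `|(scRe `|f x|)%:E| = 0)%E.
  by under eq_integral do rewrite gee0_abs ?lee_fin ?scRe_norm_ge0//.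
have mn : measurable_fun [set: X] (fun x => (scRe `|f x|)%:E).
  by apply/measurable_EFinP; exact: measurable_scRe_norm.
move=> /(ae_eq_integral_abs mu measurableT mn) f0; apply: L1_eq.
apply: filterS2 f0 L1_zeroE => x /(_ I) /= fx0 L0.
have /scRe_norm_eq0 -> : scRe `|f x| = 0 by case: fx0.
exact/esym/L0.
Qed.

HB.instance Definition _ := Lmodule_isNormed.Build K L1
  L1_normD L1_normZ L1_norm0_eq0.

End L1.

(* Main.v *)
Require Import Defs.
From mathcomp Require Import all_boot all_order all_algebra.
From mathcomp Require Import all_classical all_reals all_analysis.
From mathcomp Require Import complex.
From mathcomp Require Import measurable_realfun ring lra.
Set Implicit Arguments.
Unset Strict Implicit.
Unset Printing Implicit Defensive.
Import Order.TTheory GRing.Theory Num.Theory.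
Import numFieldNormedType.Exports.
Local Open Scope classical_set_scope.
Local Open Scope ring_scope.

(** The norm of [L1] is an integral of moduli, and the modulus has at every
    point [z], in every direction [w], a one-sided directional derivative:
    [Re (conj (sgn z) * w)] if [z <> 0], and [|w|] if [z = 0], where the modulus
    has a corner. [modulus_deriv z w] covers both cases. As the modulus is
    convex, the derivative is also a subgradient:
    [|z| + modulus_deriv z w <= |z + w|].

    Orthogonality of [f] and [g] says that [a |-> ||f + a g||] is minimal at
    [a = 0]. By convexity this happens exactly when no directional derivative
    at [0] is negative, that is, when the integral of
    [modulus_deriv (f x) (a * g x)] is nonnegative for all [a]
    ([BJ_orthogonal_deriv]). Sufficiency is the subgradient inequality,
    integrated. For necessity, the difference quotients of [t |-> ||f + t a g||]
    at [0+] are nonnegative and converge to that integral by dominated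
    convergence ([cvg_integral_quotient]): pointwise they are bounded by
    [|a g x|], and they tend to the derivative because the error of first
    order approximation is quadratic in [t] ([modulus_deriv_quadratic]).

    Let [W] be the integral of [conj (sgn f) * g] and [Z] the integral of [|g|]
    over the zeros of [f]. The integrated derivative is [Re (a W) + |a| Z]
    ([Rintegral_modulus_deriv]), and this is nonnegative for all [a] iff
    [|W| <= Z], the worst direction being [a = - conj (sgn W)]
    ([scRe_sublinear_ge0]). *)

Local Notation scalar := Defs.scalar.
Local Notation modulus z := (scRe `|z|).

(** * The modulus on the scalars and its one-sided derivative *)

Section Scalars.
Context {R : realType} {k : scalar_kind}.
Implicit Types (w x y z : scalar R k) (a t : R).

Lemma scRe_conj z : scRe (scConj z) = scRe z.
Proof. by case: k z => // -[]. Qed.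

Lemma scIm_conj z : scIm (scConj z) = - scIm z.
Proof. by case: k z => [z|[? ?]] //=; rewrite oppr0. Qed.

Lemma scReN z : scRe (- z) = - scRe z.
Proof. by case: k z => // -[]. Qed.

Lemma scIm_OfReal a : scIm (scOfReal k a) = 0.
Proof. by case: k. Qed.

Lemma scReZ a z : scRe (scOfReal k a * z) = a * scRe z.
Proof. by rewrite scReM scRe_OfReal scIm_OfReal mul0r subr0. Qed.

Lemma scImZ a z : scIm (scOfReal k a * z) = a * scIm z.
Proof. by rewrite scImM scRe_OfReal scIm_OfReal mul0r addr0. Qed.

Lemma modulus_sqr z : modulus z ^+ 2 = scRe z ^+ 2 + scIm z ^+ 2.
Proof. by rewrite scRe_norm sqr_sqrtr// addr_ge0// sqr_ge0. Qed.

Lemma modulus0 : modulus (0 : scalar R k) = 0.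
Proof. by rewrite normr0 -(scOfReal0 R k) scRe_OfReal. Qed.

Lemma modulus_eq0 z : (modulus z == 0) = (z == 0).
Proof.
by apply/eqP/eqP => [/scRe_norm_eq0//|->]; exact: modulus0.
Qed.

Lemma modulusZ a z : 0 <= a -> modulus (scOfReal k a * z) = a * modulus z.
Proof.
move=> a0; rewrite scRe_normM; congr (_ * _).
by rewrite scRe_norm scRe_OfReal scIm_OfReal expr0n addr0 sqrtr_sqr ger0_norm.
Qed.

Lemma modulus_conj z : modulus (scConj z) = modulus z.
Proof. by rewrite !scRe_norm scRe_conj scIm_conj sqrrN. Qed.

Lemma modulusN z : modulus (- z) = modulus z.
Proof. by rewrite normrN. Qed.

Lemma ler_scRe_modulus z : `|scRe z| <= modulus z.
Proof. by rewrite scRe_norm -sqrtr_sqr ler_wsqrtr// lerDl sqr_ge0. Qed.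

Lemma ler_scIm_modulus z : `|scIm z| <= modulus z.
Proof. by rewrite scRe_norm -sqrtr_sqr ler_wsqrtr// lerDr sqr_ge0. Qed.

(** With the convention that the inverse of zero is zero, one formula covers the
    two cases in the definition of [sgn]. *)
Lemma sgnE z : sgn z = scOfReal k (modulus z)^-1 * z.
Proof.
rewrite /sgn; case: eqVneq => [->|z0]; first by rewrite mulr0.
rewrite mulrC; congr (_ * _).
apply: (mulfI (x := `|z|)); first by rewrite normr_eq0.
rewrite divff ?normr_eq0// -{1}(scOfReal_norm z) -scOfRealM divff ?modulus_eq0//.
by case: (k).
Qed.

Lemma modulus_sgn z : z != 0 -> modulus (sgn z) = 1.
Proof.
move=> z0; rewrite sgnE modulusZ ?invr_ge0 ?scRe_norm_ge0//.
by rewrite mulVf ?modulus_eq0.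
Qed.

Lemma modulus_sgn_le1 z : modulus (sgn z) <= 1.
Proof.
have [->|/modulus_sgn ->//] := eqVneq z 0.
by rewrite /sgn eqxx modulus0.
Qed.

Lemma scRe_conj_sgnM z w :
  scRe (scConj (sgn z) * w) = (modulus z)^-1 * (scRe z * scRe w + scIm z * scIm w).
Proof. by rewrite scReM scRe_conj scIm_conj sgnE scReZ scImZ; ring. Qed.

Lemma scIm_conj_sgnM z w :
  scIm (scConj (sgn z) * w) = (modulus z)^-1 * (scRe z * scIm w - scIm z * scRe w).
Proof. by rewrite scImM scRe_conj scIm_conj sgnE scReZ scImZ; ring. Qed.

Lemma modulus_conj_sgnM_le z w : modulus (scConj (sgn z) * w) <= modulus w.
Proof.
rewrite scRe_normM modulus_conj ler_piMl ?scRe_norm_ge0//.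
exact: modulus_sgn_le1.
Qed.

Lemma scRe_conj_sgn_self z : scRe (scConj (sgn z) * z) = modulus z.
Proof.
have [->|z0] := eqVneq z 0.
  by rewrite mulr0 modulus0 -(scOfReal0 R k) scRe_OfReal.
rewrite scRe_conj_sgnM -!expr2 -modulus_sqr expr2 mulKf//.
by rewrite modulus_eq0.
Qed.

(** The derivative of [t |-> |z + t w|] at [0+]. The first summand vanishes at
    [z = 0] and the second one elsewhere. *)
Definition modulus_deriv z w : R :=
  scRe (scConj (sgn z) * w) + (z == 0)%:R * modulus w.

Lemma modulus_derivZ t z w : 0 <= t ->
  modulus_deriv z (scOfReal k t * w) = t * modulus_deriv z w.
Proof.
by move=> t0; rewrite /modulus_deriv mulrCA scReZ modulusZ// mulrCA mulrDr.
Qed.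

Lemma modulus_deriv0 w : modulus_deriv 0 w = modulus w.
Proof. by rewrite /modulus_deriv eqxx mul1r scRe_conj_sgnM modulus0 invr0 mul0r add0r. Qed.

Lemma modulus_deriv_neq0 z w : z != 0 ->
  modulus_deriv z w = scRe (scConj (sgn z) * w).
Proof. by move=> /negbTE z0; rewrite /modulus_deriv z0 mul0r addr0. Qed.

(** For [z <> 0] the left-hand side is [Re (conj (sgn z) * (z + w))], and
    [sgn z] has modulus one. *)
Lemma modulus_deriv_subgradient z w :
  modulus z + modulus_deriv z w <= modulus (z + w).
Proof.
have [->|z0] := eqVneq z 0; first by rewrite modulus_deriv0 modulus0 !add0r.
rewrite modulus_deriv_neq0// -{1}(scRe_conj_sgn_self z) -scReD -mulrDr.
by rewrite (le_trans (ler_norm _))// (le_trans (ler_scRe_modulus _))//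
  modulus_conj_sgnM_le.
Qed.

(** For [z <> 0] this is the inequality
    [2 * |z + w| * |z| <= |z + w| ^ 2 + |z| ^ 2] with the square of [|z + w|]
    expanded and both sides divided by [2 * |z|]. For [z = 0] the quadratic term
    is zero, the inverse of zero being zero, and equality holds. *)
Lemma modulus_deriv_quadratic z w :
  modulus (z + w) <=
    modulus z + modulus_deriv z w + (2 * modulus z)^-1 * modulus w ^+ 2.
Proof.
have [->|z0] := eqVneq z 0.
  by rewrite modulus_deriv0 modulus0 mulr0 invr0 mul0r !add0r addr0.
have n0 : 0 < modulus z by rewrite lt_def modulus_eq0 z0 scRe_norm_ge0.
rewrite modulus_deriv_neq0// scRe_conj_sgnM.
have := modulus_sqr (z + w); rewrite scReD scImD => vE.
have := modulus_sqr z; have := modulus_sqr w => wE zE.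
rewrite -(ler_pM2l (x := 2 * modulus z)) ?mulr_gt0//.
have n1 : modulus z != 0 by rewrite gt_eqF.
have -> : 2 * modulus z * (modulus z
    + (modulus z)^-1 * (scRe z * scRe w + scIm z * scIm w)
    + (2 * modulus z)^-1 * modulus w ^+ 2) =
  2 * modulus z ^+ 2 + 2 * (scRe z * scRe w + scIm z * scIm w) + modulus w ^+ 2.
  by field.
have := sqr_ge0 (modulus (z + w) - modulus z).
nra.
Qed.

Definition modulus_quotient z w t : R :=
  t^-1 * (modulus (z + scOfReal k t * w) - modulus z).

Lemma modulus_quotient_itv z w t : 0 < t ->
  modulus_deriv z w <= modulus_quotient z w t <=
    modulus_deriv z w + t * ((2 * modulus z)^-1 * modulus w ^+ 2).
Proof.
move=> t0; rewrite /modulus_quotient mulrC ler_pdivlMr// ler_pdivrMr//.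
have := modulus_deriv_subgradient z (scOfReal k t * w).
have := modulus_deriv_quadratic z (scOfReal k t * w).
rewrite modulus_derivZ ?(ltW t0)// modulusZ ?(ltW t0)//.
by move=> *; apply/andP; split; nra.
Qed.

(** The bound does not depend on [t]: it is the dominating function when the
    quotients are integrated. *)
Lemma modulus_quotient_bound z w t : 0 < t ->
  `|modulus_quotient z w t| <= modulus w.
Proof.
move=> t0; rewrite /modulus_quotient normrM gtr0_norm ?invr_gt0//.
rewrite mulrC ler_pdivrMr// [leRHS]mulrC -modulusZ ?(ltW t0)// ler_norml.
have := scRe_normD z (scOfReal k t * w).
have := scRe_normD (z + scOfReal k t * w) (- (scOfReal k t * w)).
by rewrite addrK modulusN => *; apply/andP; split; lra.
Qed.

Lemma cvg_modulus_quotient z w (t_ : nat -> R) : (forall n, 0 < t_ n) ->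
  t_ n @[n --> \oo] --> 0 ->
  modulus_quotient z w (t_ n) @[n --> \oo] --> modulus_deriv z w.
Proof.
move=> t0 tc.
apply: (@squeeze_cvgr _ _ _ _ (fun=> modulus_deriv z w)
  (fun n => modulus_deriv z w + t_ n * ((2 * modulus z)^-1 * modulus w ^+ 2))).
- by apply: nearW => n; exact: modulus_quotient_itv.
- exact: cvg_cst.
- rewrite -[X in _ --> X]addr0; apply: cvgD; first exact: cvg_cst.
  rewrite -[X in _ --> X](mul0r ((2 * modulus z)^-1 * modulus w ^+ 2)).
  by apply: cvgMr_tmp.
Qed.

End Scalars.

(** * Integrating the derivative of the modulus *)

Section Integrals.
Context {R : realType} {k : scalar_kind} {d} {X : measurableType d}.
Variable mu : {measure set X -> \bar R}.
Implicit Types f g h : X -> scalar R k.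

Lemma integrable_EFinZ (r : R) (u : X -> R) :
  mu.-integrable [set: X] (EFin \o u) ->
  mu.-integrable [set: X] (fun x => (r * u x)%:E).
Proof. by move=> Iu; exact: (integrableZl measurableT r Iu). Qed.

Lemma integrable_EFinD (u v : X -> R) :
  mu.-integrable [set: X] (EFin \o u) -> mu.-integrable [set: X] (EFin \o v) ->
  mu.-integrable [set: X] (fun x => (u x + v x)%:E).
Proof. by move=> Iu Iv; exact: (integrableD measurableT Iu Iv). Qed.

Lemma integrable_EFinB (u v : X -> R) :
  mu.-integrable [set: X] (EFin \o u) -> mu.-integrable [set: X] (EFin \o v) ->
  mu.-integrable [set: X] (fun x => (u x - v x)%:E).
Proof. by move=> Iu Iv; exact: (integrableB measurableT Iu Iv). Qed.

Lemma scIntegrable_scRe f : scIntegrable mu f ->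
  mu.-integrable [set: X] (fun x => (scRe (f x))%:E).
Proof.
move=> If; have [[mf _] _] := If.
apply: le_integrable (scIntegrable_norm If) => //.
  exact/measurable_EFinP.
move=> x _ /=; rewrite lee_fin [leRHS]ger0_norm ?scRe_norm_ge0//.
exact: ler_scRe_modulus.
Qed.

Lemma scIntegrable_scIm f : scIntegrable mu f ->
  mu.-integrable [set: X] (fun x => (scIm (f x))%:E).
Proof.
move=> If; have [[_ mf] _] := If.
apply: le_integrable (scIntegrable_norm If) => //.
  exact/measurable_EFinP.
move=> x _ /=; rewrite lee_fin [leRHS]ger0_norm ?scRe_norm_ge0//.
exact: ler_scIm_modulus.
Qed.

Lemma scRe_scIntegral D f : scRe (scIntegral mu D f) = \int[mu]_(x in D) scRe (f x).
Proof. by case: k f. Qed.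

Lemma scIm_scIntegral D f : scIm (scIntegral mu D f) = \int[mu]_(x in D) scIm (f x).
Proof. by case: k f => // f; rewrite /= /Rintegral integral0. Qed.

Lemma Rintegral_scReM a f : scIntegrable mu f ->
  \int[mu]_x scRe (a * f x) = scRe (a * scIntegral mu [set: X] f).
Proof.
move=> If; under eq_Rintegral do rewrite scReM.
have IR := scIntegrable_scRe If; have II := scIntegrable_scIm If.
rewrite RintegralB//; [|exact: integrable_EFinZ|exact: integrable_EFinZ].
by rewrite !RintegralZl// scReM scRe_scIntegral scIm_scIntegral.
Qed.

(** The inverse is the real power of exponent [-1] on nonnegative numbers, which
    is measurable on the whole line, zero included. *)
Lemma measurable_inv_modulus f : scMeasurable f ->
  measurable_fun [set: X] (fun x => (modulus (f x))^-1).
Proof.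
move=> mf; under eq_fun do rewrite -powR_inv1 ?scRe_norm_ge0//.
apply: (measurableT_comp (f := @powR R ^~ (-1))); first exact: measurable_powR.
exact: measurable_scRe_norm.
Qed.

Lemma scIntegrable_conj_sgnM f g : scMeasurable f -> scIntegrable mu g ->
  scIntegrable mu (fun x => scConj (sgn (f x)) * g x).
Proof.
move=> mf Ig; have [[gr gi] gfin] := Ig; have [fr fi] := mf.
have mw : scMeasurable (fun x => scConj (sgn (f x)) * g x).
  split.
    under eq_fun do rewrite scRe_conj_sgnM.
    apply: measurable_funM; first exact: measurable_inv_modulus.
    by apply: measurable_funD; exact: measurable_funM.
  under eq_fun do rewrite scIm_conj_sgnM.
  apply: measurable_funM; first exact: measurable_inv_modulus.
  by apply: measurable_funB; exact: measurable_funM.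
split=> //; apply: le_lt_trans gfin; apply: ge0_le_integral => //.
- by move=> x _; rewrite lee_fin scRe_norm_ge0.
- by apply/measurable_EFinP; exact: measurable_scRe_norm.
- by apply/measurable_EFinP; exact: measurable_scRe_norm.
- by move=> x _; rewrite lee_fin modulus_conj_sgnM_le.
Qed.

Lemma measurable_zero_set f : scMeasurable f -> measurable [set x | f x = 0].
Proof.
move=> /measurable_scRe_norm mf.
rewrite (_ : [set _ | _] = [set: X] `&` (fun x => modulus (f x)) @^-1` [set 0]).
  exact: mf.
by apply/seteqP; split=> x /=; [move=> ->; rewrite modulus0|case=> _ /scRe_norm_eq0].
Qed.

Lemma modulus_on_zero_set f g : 
  (fun x => (f x == 0)%:R * modulus (g x)) =
  (fun x => modulus (g x)) \_ [set x | f x = 0].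
Proof.
apply/funext => x; rewrite patchE; case: eqVneq => [fx0|/eqP fx0].
  by rewrite mul1r mem_set.
by rewrite mul0r memNset.
Qed.

Lemma integrable_on_zero_set f g : scMeasurable f -> scIntegrable mu g ->
  mu.-integrable [set: X] (fun x => ((f x == 0)%:R * modulus (g x))%:E).
Proof.
move=> mf Ig; rewrite [X in integrable _ _ X](_ : _ =
  EFin \o (fun x => (f x == 0)%:R * modulus (g x)))// modulus_on_zero_set.
rewrite -restrict_EFin.
apply: (iffLR (integrable_mkcond _ (measurable_zero_set mf))).
by apply: integrableS (scIntegrable_norm Ig) => //; exact: measurable_zero_set.
Qed.

Lemma Rintegral_modulus_deriv a f g : scMeasurable f -> scIntegrable mu g ->
  \int[mu]_x modulus_deriv (f x) (a * g x) =
    scRe (a * scIntegral mu [set: X] (fun x => scConj (sgn (f x)) * g x)) +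
    modulus a * \int[mu]_(x in [set x | f x = 0]) modulus (g x).
Proof.
move=> mf Ig; have Iw := scIntegrable_conj_sgnM mf Ig.
rewrite -Rintegral_scReM// [X in _ + _ * X]Rintegral_mkcond -modulus_on_zero_set.
rewrite -RintegralZl//; last exact: integrable_on_zero_set.
rewrite -RintegralD//; last 2 first.
- exact: (scIntegrable_scRe (scIntegrableZ a Iw)).
- exact/integrable_EFinZ/integrable_on_zero_set.
apply: eq_Rintegral => x _.
by rewrite /modulus_deriv (mulrCA _ a) scRe_normM (mulrCA _ (modulus a)).
Qed.

Lemma integrable_modulus_deriv f g : scMeasurable f -> scIntegrable mu g ->
  mu.-integrable [set: X] (fun x => (modulus_deriv (f x) (g x))%:E).
Proof.
move=> mf Ig; apply: integrable_EFinD.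
- exact/scIntegrable_scRe/scIntegrable_conj_sgnM.
- exact: integrable_on_zero_set.
Qed.

Lemma cvg_integral_quotient f g (t_ : nat -> R) : scIntegrable mu f ->
  scIntegrable mu g -> (forall n, 0 < t_ n) -> t_ n @[n --> \oo] --> 0 ->
  (\int[mu]_x (modulus_quotient (f x) (g x) (t_ n))%:E @[n --> \oo] -->
    \int[mu]_x (modulus_deriv (f x) (g x))%:E)%E.
Proof.
move=> If Ig t0 tc.
have [mf _] := If; have Id := integrable_modulus_deriv mf Ig.
have [] := @dominated_convergence _ X R mu [set: X] measurableT
  (fun n x => (modulus_quotient (f x) (g x) (t_ n))%:E)
  (fun x => (modulus_deriv (f x) (g x))%:E)
  (fun x => (modulus (g x))%:E).
- move=> n; apply/measurable_EFinP/measurable_funM => //.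
  have [mD _] := scIntegrableD If (scIntegrableZ (scOfReal k (t_ n)) Ig).
  by apply: measurable_funB; apply: measurable_scRe_norm.
- exact: measurable_int Id.
- apply: aeW => x _; apply/fine_cvgP; split; first exact: nearW.
  exact: cvg_modulus_quotient.
- exact: scIntegrable_norm.
- by apply: aeW => x n _; rewrite lee_fin modulus_quotient_bound.
by [].
Qed.

End Integrals.

(** * Orthogonality as nonnegativity of the derivative *)

Section L1.
Context {R : realType} {k : scalar_kind} {d} {X : measurableType d}.
Context {mu : {measure set X -> \bar R}}.
Implicit Types f g : L1 k mu.

(** Norms in [L1] are computed on chosen representatives, and that of
    [f + a *: g] agrees only almost everywhere with the pointwise expression. *)
Lemma BJ_orthogonal_L1E f g : BJ_orthogonal f g <->
  forall a, \int[mu]_x modulus (f x) <= \int[mu]_x modulus (f x + a * g x).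
Proof.
have normE a : `|f + a *: g| = scOfReal k (\int[mu]_x modulus (f x + a * g x)).
  apply: L1_normE.
    exact/scIntegrableD/scIntegrableZ/L1_integrable/L1_integrable.
  apply: filterS2 (L1_addE f (a *: g)) (L1_scaleE a g) => x.
  by move=> + <-.
have fE : `|f| = scOfReal k (\int[mu]_x modulus (f x)) by exact: scIntegral_norm.
by split=> fg a; have := fg a; rewrite normE fE scOfReal_le.
Qed.

(** The minimum criterion for the convex function [a |-> ||f + a g||]: a point is
    a global minimum iff all one-sided directional derivatives there are
    nonnegative. *)
Lemma BJ_orthogonal_deriv f g : BJ_orthogonal f g <->
  forall a, 0 <= \int[mu]_x modulus_deriv (f x) (a * g x).
Proof.
have If := L1_integrable f; have Ig a := scIntegrableZ a (L1_integrable g).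
have [mf _] := If; have Id a := integrable_modulus_deriv mf (Ig a).
have IN := scIntegrable_norm If.
have IfD h (Ih : scIntegrable mu h) := scIntegrable_norm (scIntegrableD If Ih).
rewrite BJ_orthogonal_L1E; split=> [fg a|fg a]; last first.
  apply: (@le_trans _ _
      (\int[mu]_x (modulus (f x) + modulus_deriv (f x) (a * g x)))).
    by rewrite (RintegralD measurableT IN (Id a)) lerDl.
  apply: le_Rintegral => //.
  - exact: integrable_EFinD (Id a).
  - exact: IfD.
  - by move=> x _; exact: modulus_deriv_subgradient.
(* The step sizes [1 / n.+1]; each quotient is nonnegative because [f] is
   orthogonal to [g]. *)
rewrite /Rintegral fine_ge0//.
apply: (cvge_ge _ (cvg_integral_quotient If (Ig a) _ cvg_harmonic)).
  apply: nearW => n.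
  set t : R := harmonic n.
  have It := scIntegrableZ (scOfReal k t) (Ig a).
  have IB := integrable_EFinB (IfD _ It) IN.
  have -> : (\int[mu]_x (modulus_quotient (f x) (a * g x) t)%:E)%E =
      (\int[mu]_x modulus_quotient (f x) (a * g x) t)%:E.
    rewrite fineK//; apply: integrable_fin_num => //.
    exact: integrable_EFinZ IB.
  rewrite lee_fin (RintegralZl _ measurableT IB).
  rewrite (RintegralB measurableT (IfD _ It) IN).
  rewrite mulr_ge0 ?invr_ge0 ?subr_ge0//.
  rewrite (le_trans (fg (scOfReal k t * a)))//.
  by under eq_Rintegral do rewrite -mulrA.
by move=> n; rewrite /harmonic /= invr_gt0.
Qed.

End L1.

(** [modulus W] is the maximum of [- scRe (a * W)] over [a] of modulus at most
    one. *)
Lemma scRe_sublinear_ge0 {R : realType} {k : scalar_kind} (W : scalar R k) (Z : R) :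
  0 <= Z ->
  (forall a, 0 <= scRe (a * W) + modulus a * Z) <-> modulus W <= Z.
Proof.
move=> Z0; split=> [h|WZ a].
  (* In this direction [scRe (a * W)] is [- modulus W], with [modulus a <= 1]. *)
  have := h (- scConj (sgn W)).
  rewrite mulNr scReN scRe_conj_sgn_self modulusN modulus_conj.
  have := modulus_sgn_le1 W; have := scRe_norm_ge0 (sgn W); nra.
have := ler_scRe_modulus (a * W); rewrite scRe_normM ler_norml => /andP[lo _].
have := ler_wpM2l (scRe_norm_ge0 a) WZ; lra.
Qed.

Theorem theorem3p0p2 (R : realType) (k : scalar_kind) (d : measure_display)
    (X : measurableType d) (lambda : {measure set X -> \bar R})
    (f g : L1 k lambda) :
  BJ_orthogonal f g <->
  `|scIntegral lambda [set: X] (fun x => scConj (sgn (f x)) * g x)|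
    <= scIntegral lambda [set x | f x = 0] (fun x => `|g x|).
Proof.
have [mf _] := L1_integrable f; have Ig := L1_integrable g.
rewrite BJ_orthogonal_deriv -scOfReal_norm scIntegral_norm scOfReal_le.
rewrite -scRe_sublinear_ge0; last first.
  by apply: Rintegral_ge0 => x _; exact: scRe_norm_ge0.
by split=> h a; have := h a; rewrite Rintegral_modulus_deriv.
Qed.
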